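(* Let $G$ be a finite elementary abelian $2$-group of order $2^n$. Then the number $c_3(G)$ of distinct coverings of $G$ with three proper subgroups is $$c_3(G)=\frac{2^{2n-1}-3\cdot 2^{n-1}+1}{3}.$$
   Context: A subgroup $H$ of $G$ is proper if $H\neq G$. A covering of $G$ with three proper subgroups is an (unordered) set $\{H_1,H_2,H_3\}$ of three proper subgroups of $G$ with $G=H_1\cup H_2\cup H_3$, and $c_3(G)$ denotes the number of such sets. *)

(* Defs.v *)
From mathcomp Require Import all_boot all_order all_algebra.
From mathcomp Require Import all_fingroup all_solvable.

Set Implicit Arguments.
Unset Strict Implicit.
Unset Printing Implicit Defensive.

Import GroupScope.

Definition coverings3 (gT : finGroupType) (G : {group gT}) :
    {set {set {group gT}}} :=
  [set C : {set {group gT}} |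
    [&& #|C| == 3, [forall H in C, H \proper G]
      & \bigcup_(H in C) (H : {set gT}) == G]].

Definition num_coverings3 (gT : finGroupType) (G : {group gT}) : nat := #|coverings3 G|.

(* Main.v *)
(* In a 2-group the members of a covering by three proper subgroups all have
   index 2, and two distinct subgroups H and K of index 2 lie in exactly one
   such covering, whose third member is (H :&: K) together with G :\: (H :|: K).
   Counting pairs contained in a covering gives 'C(m, 2) = 3 * c_3(G), where m is
   the number of subgroups of index 2. In an elementary abelian 2-group these
   are the kernels of the nontrivial irreducible characters, which take only the
   values 1 and -1 and so are determined by their kernels; hence m = 2^n - 1. *)

Require Import Defs.
From mathcomp Require Import all_boot all_order all_algebra.
From mathcomp Require Import all_fingroup all_solvable.
From mathcomp Require Import all_field all_character.
From mathcomp Require Import ring zify.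

Section IndexTwo.

Set Implicit Arguments.
Unset Strict Implicit.

Import GroupScope.
Local Open Scope group_scope.

Context {gT : finGroupType}.
Implicit Types (G H K L : {group gT}) (C : {set {group gT}}).

(** * Subgroups of index 2 *)

Definition index2_subgroups G : {set {group gT}} :=
  [set H : {group gT} | (H \subset G) && (#|G : H| == 2)].

Lemma index2_card G H : H \in index2_subgroups G -> (#|H| * 2)%N = #|G|.
Proof. by rewrite inE => /andP[sHG /eqP <-]; exact: Lagrange. Qed.

Lemma index2_sub G H : H \in index2_subgroups G -> H \subset G.
Proof. by rewrite inE => /andP[]. Qed.

Lemma index2_proper G H : H \in index2_subgroups G -> H \proper G.
Proof. by rewrite inE properE -indexg_gt1 => /andP[-> /eqP->]. Qed.

(** Membership in [H] behaves as a sign character. The case of two elements outside [H] holds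
    because the coset [x^-1 *: H] avoids [H] and has the size of [G :\: H]. *)
Lemma index2_mulE G H x y : H \in index2_subgroups G ->
  x \in G -> y \in G -> (x * y \in H) = ((x \in H) == (y \in H)).
Proof.
move=> iH Gx Gy; have sHG := index2_sub iH.
have [Hx | nHx] := boolP (x \in H); first by rewrite groupMl //=; case: (_ \in _).
have [Hy | nHy] := boolP (y \in H); first by rewrite groupMr // (negPf nHx).
have: x^-1 *: H == G :\: H.
  rewrite eqEcard; apply/andP; split.
    apply/subsetP=> z; rewrite mem_lcoset invgK inE => Hxz.
    rewrite -(groupMl z Gx) (subsetP sHG _ Hxz) andbT.
    by apply: contra nHx => Hz; rewrite -(groupMr x Hz).
  rewrite card_lcoset cardsD (setIidPr sHG) -(index2_card iH).
  by rewrite muln2 -addnn addnK.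
by move/eqP/setP/(_ y); rewrite mem_lcoset invgK !inE Gy nHy.
Qed.

(** For a fixed [z] in [G :\: H] the hypothesis puts all of [G :\: H] in the single coset
    [z^-1 *: H], so the index is at most 2. *)
Lemma index2_of_mul G H : H \proper G ->
  (forall x y, x \in G :\: H -> y \in G :\: H -> x * y \in H) ->
  H \in index2_subgroups G.
Proof.
move=> prH HM; have sHG := proper_sub prH.
have [_ [z Gz nHz]] := properP prH.
have sD : G :\: H \subset z^-1 *: H.
  apply/subsetP=> y Dy; rewrite mem_lcoset invgK HM //.
  by rewrite inE nHz.
have := subset_leq_card sD.
rewrite card_lcoset cardsD (setIidPr sHG) leq_subLR addnn -muln2.
rewrite -(Lagrange sHG) leq_pmul2l ?cardG_gt0 // => le2.
rewrite inE sHG eqn_leq le2 indexg_gt1.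
by case/andP: prH.
Qed.

Lemma index2_sub_eq G H K : H \in index2_subgroups G ->
  K \in index2_subgroups G -> H \subset K -> H = K.
Proof.
move=> iH iK sHK; apply/val_inj/eqP; rewrite eqEcard sHK /=.
by rewrite -(leq_pmul2r (isT : 0 < 2)) (index2_card iH) (index2_card iK).
Qed.

Lemma index2_notinU G H K : H \in index2_subgroups G ->
    K \in index2_subgroups G -> H != K ->
  exists z, [/\ z \in G, z \notin H & z \notin K].
Proof.
move=> iH iK neHK.
have nsub A B : A \in index2_subgroups G -> B \in index2_subgroups G ->
    A != B -> exists2 a, a \in A & a \notin B.
  move=> iA iB neAB; apply/subsetPn.
  by apply: contra neAB => /(index2_sub_eq iA iB)->.
have [a Ha nKa] := nsub _ _ iH iK neHK.
have [b Kb nHb] : exists2 b, b \in K & b \notin H by apply: nsub; rewrite 1?eq_sym.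
(* With [a] in [H] only and [b] in [K] only, the product lies in neither. *)
exists (a * b); split.
- by apply: groupM; [apply: subsetP Ha | apply: subsetP Kb]; apply: index2_sub.
- by rewrite groupMl.
- by rewrite groupMr.
Qed.

(* Third subgroup of index 2 above H :&: K: the characters with kernels H and K
   have a product whose kernel is this set. *)
Definition third_set G H K := [set x in G | (x \in H) == (x \in K)].

Lemma third_group_set G H K : H \in index2_subgroups G ->
  K \in index2_subgroups G -> group_set (third_set G H K).
Proof.
move=> iH iK; apply/group_setP; split=> [|x y]; first by rewrite !inE !group1.
rewrite !inE => /andP[Gx /eqP ex] /andP[Gy /eqP ey].
by rewrite groupM // (index2_mulE iH) // (index2_mulE iK) // ex ey eqxx.
Qed.

(** An element of [G] outside [L] lies in exactly one of [H] and [K]; in a product of two such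
    elements the two sign discrepancies cancel. *)
Lemma third_index2 G H K L : H \in index2_subgroups G ->
    K \in index2_subgroups G -> H != K -> L = third_set G H K :> {set gT} ->
  L \in index2_subgroups G.
Proof.
move=> iH iK neHK eL; apply: index2_of_mul.
  rewrite properE eL; apply/andP; split.
    by apply/subsetP=> x; rewrite inE => /andP[].
  apply: contra neHK => /subsetP sG; apply/eqP/(index2_sub_eq iH iK).
  apply/subsetP=> x Hx; have Gx := subsetP (index2_sub iH) _ Hx.
  by have := sG x Gx; rewrite inE Hx Gx => /eqP <-.
move=> x y; rewrite eL !inE => /andP[nx Gx] /andP[ny Gy].
rewrite Gx Gy /= in nx ny *.
rewrite groupM // (index2_mulE iH) // (index2_mulE iK) //.
by move: nx ny; do 4!case: (_ \in _).
Qed.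

Lemma third_neq G H K L : H \in index2_subgroups G ->
    K \in index2_subgroups G -> L = third_set G H K :> {set gT} ->
  (L != H) && (L != K).
Proof.
move=> iH iK eL.
have memL x : (x \in L) = (x \in G) && ((x \in H) == (x \in K)).
  by rewrite -[x \in L]/(x \in (L : {set gT})) eL inE.
apply/andP; split; apply/eqP=> eLA.
  have := index2_proper iK; rewrite properE => /andP[_ /subsetP[]] x Gx.
  by have := memL x; rewrite eLA Gx /=; do 2!case: (_ \in _).
have := index2_proper iH; rewrite properE => /andP[_ /subsetP[]] x Gx.
by have := memL x; rewrite eLA Gx /=; do 2!case: (_ \in _).
Qed.

Lemma covering_third G H K L : H \in index2_subgroups G ->
    K \in index2_subgroups G -> L \in index2_subgroups G ->
    H != K -> L != H -> L != K -> G \subset H :|: K :|: L ->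
  L = third_set G H K :> {set gT}.
Proof.
move=> iH iK iL neHK neLH neLK /subsetP cov.
have [z [Gz nHz nKz]] := index2_notinU iH iK neHK.
have outL x : x \in G -> x \notin H -> x \notin K -> x \in L.
  by move=> Gx nHx nKx; have := cov x Gx; rewrite !inE (negPf nHx) (negPf nKx).
have Lz := outL z Gz nHz nKz.
(* Multiplying [x] by [z] leaves both [H] and [K], so [z * x] is in [L] along with [z]. *)
have interL x : x \in H -> x \in K -> x \in L.
  move=> Hx Kx; have Gx := subsetP (index2_sub iH) _ Hx.
  by rewrite -(groupMl x Lz) outL ?groupMr.
(* If some [x] of [A] outside [B] were in [L], then for every other such [y] the product [x * y]
   would be in both [A] and [B], hence in [L]; this would force [A] into [L]. *)
have diffL A B : A \in index2_subgroups G -> B \in index2_subgroups G ->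
    L != A -> (forall x, x \in A -> x \in B -> x \in L) ->
    forall x, x \in A -> x \notin B -> x \notin L.
  move=> iA iB neLA inter x Ax nBx; apply: contra neLA => Lx.
  apply/eqP/esym/(index2_sub_eq iA iL)/subsetP=> y Ay.
  have [By | nBy] := boolP (y \in B); first exact: inter.
  rewrite -(groupMl y Lx) inter ?(groupM Ax Ay) //.
  have sAG := subsetP (index2_sub iA).
  by rewrite (index2_mulE iB) ?sAG // (negPf nBx) (negPf nBy).
apply/setP=> x; rewrite inE.
have [Gx | nGx] := boolP (x \in G); last first.
  by apply: contraNF nGx; apply/subsetP/index2_sub.
have [Hx | nHx] := boolP (x \in H); have [Kx | nKx] := boolP (x \in K) => /=.
- exact: interL.
- by apply/negbTE; apply: (diffL H K).
- by apply/negbTE; apply: (diffL K H) => // y Ky Hy; apply: interL.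
- exact: outL.
Qed.

(** * Coverings by three proper subgroups *)

Lemma cards3_of_mem (T : finType) (C : {set T}) x : #|C| = 3 -> x \in C ->
  exists y z, [/\ C = [set x; y; z], x != y, z != x & z != y].
Proof.
move=> C3 Cx; have := cardsD1 x C; rewrite C3 Cx.
case=> /esym/eqP/cards2P[y [z [neyz eC]]].
have neq w : w \in C :\ x -> x != w by rewrite !inE eq_sym => /andP[].
exists y, z; rewrite -setUA -eC setD1K // !(eq_sym z).
by split; rewrite // neq // eC !inE eqxx ?orbT.
Qed.

Lemma mem_coverings3 G H K L : H != K -> L != H -> L != K ->
  ([set H; K; L] \in coverings3 G) =
  [&& H \proper G, K \proper G, L \proper G & G \subset H :|: K :|: L].
Proof.
move=> neHK neLH neLK; rewrite inE; apply/and3P/and4P.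
  case=> _ /forall_inP prC /eqP covC.
  by rewrite !prC ?inE ?eqxx ?orbT // -covC !bigcup_setU !big_set1.
case=> pH pK pL sG; split.
- by rewrite -setUA cardsU1 cards2 !inE negb_or neHK (eq_sym H L) neLH (eq_sym K L) neLK.
- by apply/forall_inP=> A; rewrite !inE -orbA => /or3P[]/eqP->.
- by rewrite !bigcup_setU !big_set1 eqEsubset sG !subUset !proper_sub.
Qed.

(* K :|: L has at most 3/4 of the elements of G and the others lie in H :\ 1, so
   the index of H is a power of 2 less than 4. *)
Lemma coverings3_index2 G C H : 2.-group G -> C \in coverings3 G -> H \in C ->
  H \in index2_subgroups G.
Proof.
move=> pG cC CH; have C3 : #|C| = 3 by move: cC; rewrite inE => /and3P[/eqP].
have [K [L [eC neHK neLH neLK]]] := cards3_of_mem C3 CH.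
move: cC; rewrite eC mem_coverings3 // => /and4P[prH prK prL sG].
have sHG := proper_sub prH; have sKG := proper_sub prK.
have sLG := proper_sub prL.
have half (A : {group gT}) : A \proper G -> (2 * #|A| <= #|G|)%N.
  move=> prA; rewrite -(Lagrange (proper_sub prA)) mulnC leq_pmul2l ?cardG_gt0 //.
  by rewrite indexg_gt1; case/andP: prA.
have cKL : (#|K| * #|L| <= #|G| * #|K :&: L|)%N.
  by rewrite mul_cardG leq_pmul2r ?cardG_gt0 // subset_leq_card // mul_subG.
have cU : #|G| <= #|H :\ 1| + #|K :|: L|.
  apply: leq_trans (leq_card_setU _ _); apply/subset_leq_card/subsetP=> x Gx.
  have := subsetP sG x Gx; rewrite !inE.
  have [-> | _] := eqVneq x 1; first by rewrite !group1 !orbT.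
  by rewrite orbA.
have := cardsUI K L; have := cardsD1 1 H; rewrite group1 => c1 cI.
have lt4 : (#|G| < 4 * #|H|)%N.
  have:= half K prK; have:= half L prL; move: cKL cU c1 cI (cardG_gt0 G).
  move: #|G| #|H :\ 1| #|H| #|K| #|L| #|K :&: L| #|K :|: L|.
  move=> g h' h k l i u cKL cU c1 cI g_gt0 l2 k2.
  (* Expand [(g - 2 * k) * (g - 2 * l) >= 0] and bound [k * l] by [g * i]. With [k + l <= g] this
     gives [4 * u <= 3 * g]. *)
  have: (2 * (k + l) <= 4 * i + g)%N.
    rewrite -(leq_pmul2l g_gt0).
    nia.
  lia.
rewrite inE sHG /=.
have [j ej] := p_natP (pnat_dvd (dvdn_indexg G H) pG).
have: #|G : H| < 4.
  by rewrite -(ltn_pmul2l (cardG_gt0 H)) Lagrange // mulnC.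
have: 1 < #|G : H| by rewrite indexg_gt1; case/andP: prH.
by rewrite ej; case: j {ej} => [|[|j]] // _; rewrite !expnS; lia.
Qed.

(** Existence comes from [third_set]. For uniqueness, the remaining member of a covering has index 2
    by [coverings3_index2], and [covering_third] then determines it. *)
Lemma card_coverings3_of_pair G (D : {set {group gT}}) :
    2.-group G -> D \subset index2_subgroups G -> #|D| = 2 ->
  #|[set C in coverings3 G | D \subset C]| = 1%N.
Proof.
move=> pG sD /eqP/cards2P[H [K [neHK eD]]].
have iH : H \in index2_subgroups G by rewrite (subsetP sD) // eD !inE eqxx.
have iK : K \in index2_subgroups G by rewrite (subsetP sD) // eD !inE eqxx orbT.
pose L := Group (third_group_set iH iK).
have eL : L = third_set G H K :> {set gT} by [].
have /andP[neLH neLK] := third_neq iH iK eL.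
have iL := third_index2 iH iK neHK eL.
apply/eqP/cards1P; exists [set H; K; L]; apply/setP=> C; rewrite !inE.
apply/idP/eqP=> [/andP[cC sDC] | ->]; last first.
  apply/andP; split; last by rewrite eD subsetUl.
  have := mem_coverings3 G neHK neLH neLK; rewrite inE => ->.
  rewrite !index2_proper //; apply/subsetP=> x Gx; rewrite !inE Gx.
  by case: (_ \in H); case: (_ \in K).
have {}cC : C \in coverings3 G by rewrite inE.
have C3 : #|C| = 3 by move: cC; rewrite inE => /and3P[/eqP].
have [CH CK] : H \in C /\ K \in C.
  by split; apply: (subsetP sDC); rewrite eD !inE eqxx ?orbT.
have /eqP/cards1P[A eA]: #|C :\ H :\ K| = 1%N.
  have := cardsD1 K (C :\ H); have := cardsD1 H C.
  by rewrite C3 CH !inE CK (eq_sym K) neHK /=; lia.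
have: A \in C :\ H :\ K by rewrite eA inE.
rewrite !inE => /and3P[neAK neAH CA].
have eC : C = [set H; K; A].
  rewrite -(setD1K CH) -(setD1K (_ : K \in C :\ H)) ?eA ?setUA //.
  by rewrite !inE eq_sym neHK.
have iA := coverings3_index2 pG cC CA.
rewrite eC; congr (_ :|: [set _]); apply: val_inj => /=.
apply: covering_third => //.
by move: cC; rewrite eC mem_coverings3 // => /and4P[].
Qed.

Lemma num_coverings3_bin G : 2.-group G ->
  'C(#|index2_subgroups G|, 2) = (num_coverings3 G * 3)%N.
Proof.
move=> pG; set M := index2_subgroups G.
pose P := [set D : {set {group gT}} | D \subset M & #|D| == 2].
rewrite -cards_draws -/P -sum1_card.
transitivity (\sum_(D in P) \sum_(C in coverings3 G | D \subset C) 1)%N.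
  apply: eq_bigr => D; rewrite inE => /andP[sD /eqP D2].
  rewrite -[LHS](card_coverings3_of_pair pG sD D2) -sum1_card.
  by apply: eq_bigl => C; rewrite inE.
rewrite (exchange_big_dep (mem (coverings3 G))) => [|D C _ /andP[]] //=.
rewrite -sum_nat_const; apply: eq_bigr => C cC.
have C3 : #|C| = 3 by move: cC; rewrite inE => /and3P[/eqP].
(* The factor 3 counts the pairs inside [C], all of which consist of subgroups of index 2. *)
rewrite -[RHS]/('C(3, 2)) -C3 -cards_draws -sum1_card; apply: eq_bigl => D.
rewrite cC ![D \in _]inE -andbA /=.
apply/and3P/andP=> [[] | [sDC D2]] //.
by split=> //; apply: subset_trans sDC _; apply/subsetP=> H; apply: coverings3_index2.
Qed.

(** * Counting the subgroups of index 2 by characters *)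

Local Open Scope ring_scope.

Lemma card_index2_subgroups G : (2.-abelem G)%g -> #|index2_subgroups G| = #|G|.-1.
Proof.
move=> abelG; have [abG exG] := abelemP (isT : prime 2) abelG.
have linG i : 'chi[G]_i \is a linear_char by apply: char_abelianP.
have sqr i x : x \in G -> ('chi[G]_i x == 1) || ('chi[G]_i x == -1).
  by move=> Gx; rewrite -GRing.sqrf_eq1 -lin_charX // exG // lin_char1.
have memK i x : x \in G -> (x \in cfker 'chi[G]_i) = ('chi[G]_i x == 1).
  by move=> Gx; rewrite cfkerEirr inE lin_char1.
pose ker i : {group gT} := [group of cfker 'chi[G]_i].
have injk : injective ker.
  move=> i j eij; apply: irr_inj; apply/cfun_inP=> x Gx.
  have: (x \in cfker 'chi_i) = (x \in cfker 'chi_j).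
    by rewrite -[cfker _]/(ker i : {set gT}) eij.
  rewrite !memK //; have := sqr j x Gx; have := sqr i x Gx.
  case: ('chi_i x =P 1) => [-> _ _ /esym/eqP-> // | _ /= /eqP-> sj ej].
  by move: sj; rewrite -ej => /eqP->.
have iK i : i != 0 -> ker i \in index2_subgroups G.
  move=> nz; apply: index2_of_mul.
    by rewrite properE cfker_sub subGcfker.
  have neg x : x \in G :\: ker i -> 'chi_i x = -1.
    case/setDP=> Gx; have := sqr i x Gx; rewrite -memK //.
    by case/orP=> [-> // | /eqP].
  move=> x y Dx Dy; have /setDP[Gx _] := Dx; have /setDP[Gy _] := Dy.
  by rewrite memK ?groupM // lin_charM // !neg // GRing.mulrNN GRing.mulr1.
have ->: index2_subgroups G = ker @: [set~ 0].
  apply/setP=> H; apply/idP/imsetP=> [iH | [i]]; last first.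
    by rewrite in_setC1 => nz ->; apply: iK.
  have nH : (H <| G)%g by rewrite -sub_abelian_normal ?index2_sub.
  (* A normal subgroup is the intersection of the kernels of the irreducible characters trivial on
     it. If only the principal character were trivial on [H], that intersection would be [G]. *)
  have [i nz_sHi | all0] :=
    pickP [pred i | (i != 0) && (H \subset cfker 'chi[G]_i)].
    have /andP[/= nz sHi] := nz_sHi; exists i; first by rewrite !inE.
    exact: index2_sub_eq iH (iK _ nz) sHi.
  have := index2_proper iH; rewrite properE => /andP[_ /negP[]].
  rewrite -(cap_cfker_normal nH); apply/bigcapsP=> i sHi; rewrite subGcfker.
  by have := all0 i; rewrite /= sHi andbT => /negbFE.
by rewrite card_imset // cardsC1 card_Iirr_abelian.
Qed.

End IndexTwo.

(** * The formula over the rationals *)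

Import GRing.Theory Num.Theory.
Local Open Scope ring_scope.

(* MathComp; the equation is in the rationals and the exponents of 2 are
   integers, so that 2n - 1 and n - 1 are not truncated at n = 0. *)
Theorem mainTheorem7 (gT : finGroupType) (G : {group gT}) (n : nat)
    (abelG : (2.-abelem G)%g) (cardG : #|G| = (2 ^ n)%N) :
  (num_coverings3 G)%:R =
    ((2 : rat) ^ (2 * n%:Z - 1) - 3 * (2 : rat) ^ (n%:Z - 1) + 1) / 3 :> rat.
Proof.
have := num_coverings3_bin (abelem_pgroup abelG).
rewrite (card_index2_subgroups abelG) cardG => eC.
have {}eC : (num_coverings3 G * 6 = (2 ^ n).-1 * (2 ^ n).-2)%N.
  by rewrite -[6%N]/(3 * 2`!)%N mulnA -eC bin_ffact ffactnS ffactn1.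
have {}eC : (num_coverings3 G)%:R * 6 = (2 ^+ n - 1) * (2 ^+ n - 2) :> rat.
  rewrite -[6]/(6%:R) -natrM eC natrM.
  have: (0 < 2 ^ n)%N by rewrite expn_gt0.
  rewrite -[2]/(2%:R : rat) -natrX.
  (* When [2 ^ n] is 1, the truncated [.-2] gives 0 instead of -1, which is harmless because the
     other factor is 0. *)
  case: (2 ^ n)%N => [|[|m]] // _; rewrite -!pred_Sn -natr1 -natr1; ring.
have e2 : 2 ^ (2 * n%:Z - 1) = (2 ^+ n) ^+ 2 / 2 :> rat.
  by rewrite expfzDr // -PoszM -exprnP -exprM mulnC.
have e1 : 2 ^ (n%:Z - 1) = 2 ^+ n / 2 :> rat by rewrite expfzDr.
rewrite e1 e2; apply: (mulIf (_ : 6 != 0 :> rat)) => //.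
by rewrite eC; field.
Qed.
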